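(* Let $c \ge 1$, $k \ge 1$ and $n \ge (c+1)^3 + (c+1)$ be integers. In the two-player $(c,k)$-nacci Zeckendorf game starting from $n$ copies of $S_1 = 1$: if $c$ is odd, then Player $2$ has a winning strategy; if $c$ is even, then Player $1$ has a winning strategy.
   Context: For integers $c, k \ge 1$, the $(c,k)$-nacci numbers are defined by $S_1 = 1$; $S_{i+1} = cS_i + cS_{i-1} + \cdots + cS_1 + 1$ for $1 \le i \le k$; and $S_{i+1} = cS_i + cS_{i-1} + \cdots + cS_{i-k}$ for $i \ge k+1$. The two-player $(c,k)$-nacci Zeckendorf game on $n$: a position is a finite unordered list (multiset) of $(c,k)$-nacci numbers; the initial position consists of $n$ copies of $S_1$. Players $1$ and $2$ alternate turns, Player $1$ moving first. Here $aS_i$ denotes $a$ copies of $S_i$. On each turn the player whose turn it is makes one of the following moves, provided the terms on the left are present in the list with at least the indicated multiplicities; they are removed and replaced by the terms on the right: 1. $cS_{i-k} \wedge cS_{i-k+1} \wedge \cdots \wedge cS_i \to S_{i+1}$, for $i \ge k+1$; 2. $(c+1)S_1 \wedge cS_2 \wedge \cdots \wedge cS_i \to S_{i+1}$, for $1 \le i \le k$; 3. (a) $(c+1)S_1 \to S_2$; (b) $(c+1)S_i \to S_{i+1}$ for $1 < i < k+1$; (c) $(c+1)S_{k+1} \to S_{k+2} \wedge S_1$; (d) $(c+1)S_i \to S_{i+1} \wedge cS_{i-k-1}$ for $i > k+1$. The game ends when no move is available, and the player who made the final move wins. A player has a winning strategy if that player can guarantee making the final move whatever the opponent does. *)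

(* Defs.v *)
From HB Require Import structures.
From mathcomp Require Import all_boot.
From mathcomp Require Import finmap multiset.

Set Implicit Arguments.
Unset Strict Implicit.
Unset Printing Implicit Defensive.

Local Open Scope mset_scope.
Local Open Scope nat_scope.

(* [:: S_m; ...; S_1], latest term first; the initial recurrence, read with an
   empty sum, also produces S_1 = 1. *)
Fixpoint rev_naccis (c k m : nat) : seq nat :=
  if m is i.+1 then
    let s := rev_naccis c k i in
    (if i <= k then c * sumn s + 1 else c * sumn (take k.+1 s)) :: s
  else [::].

(* The (c,k)-nacci number S_i, for i >= 1 (nacci c k 0 = 0 is a dummy value). *)
Definition nacci (c k i : nat) : nat := head 0 (rev_naccis c k i).

Lemma size_rev_naccis c k m : size (rev_naccis c k m) = m.
Proof. by elim: m => //= m ->. Qed.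

Lemma take_rev_naccis c k m j : j <= m ->
  sumn (take j (rev_naccis c k m)) = \sum_(m.+1 - j <= l < m.+1) nacci c k l.
Proof.
elim: m j => [|m IHm] [|j] lejm //; first by rewrite big_geq.
  by rewrite take0 subn0 big_geq.
by rewrite subSS big_nat_recr ?leq_subr //= -IHm // addnC.
Qed.

Lemma nacci1 c k : nacci c k 1 = 1.
Proof. by rewrite /nacci /= muln0. Qed.

Lemma nacciS_small c k i : 1 <= i <= k ->
  nacci c k i.+1 = \sum_(1 <= j < i.+1) c * nacci c k j + 1.
Proof.
case/andP=> _ leik; rewrite [LHS]/nacci /= leik -big_distrr /=.
have := take_rev_naccis c k (leqnn i).
by rewrite subSnn -{1}(size_rev_naccis c k i) take_size => ->.
Qed.

Lemma nacciS_large c k i : k.+1 <= i ->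
  nacci c k i.+1 = \sum_(i - k <= j < i.+1) c * nacci c k j.
Proof.
move=> ltki; rewrite [LHS]/nacci /= leqNgt ltki /= -big_distrr /=.
by rewrite take_rev_naccis // subSS.
Qed.

HB.instance Definition _ :=
  Monoid.isComLaw.Build {mset nat} mset0 (@msetD nat)
    (@msetDA nat) (@msetDC nat) (@mset0D nat).

Definition position : Type := {mset nat}.

(* rule c k A B : the terms A may be replaced by the terms B. *)
Section Rules.
Variables c k : nat.
Local Notation S := (nacci c k).

Inductive rule : position -> position -> Prop :=
| Combine i of k.+1 <= i :
    rule (\big[msetD/mset0]_(i - k <= j < i.+1) msetn c (S j)) [mset S i.+1]
| CombineInit i of 1 <= i <= k :
    rule (msetn c.+1 (S 1)
            `+` \big[msetD/mset0]_(2 <= j < i.+1) msetn c (S j))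
         [mset S i.+1]
| CarryFirst :
    rule (msetn c.+1 (S 1)) [mset S 2]
| CarryInit i of 1 < i < k.+1 :
    rule (msetn c.+1 (S i)) [mset S i.+1]
| SplitFirst :
    rule (msetn c.+1 (S k.+1)) ([mset S k.+2] `+` [mset S 1])
| Split i of k.+1 < i :
    rule (msetn c.+1 (S i)) ([mset S i.+1] `+` msetn c (S (i - k - 1))).

Inductive move : position -> position -> Prop :=
| Move A B C of rule A B : move (A `+` C) (B `+` C).

End Rules.

Definition terminal (c k : nat) (p : position) : Prop :=
  forall q, ~ move c k p q.

Inductive player := Player1 | Player2.

(* Turns are numbered from 0. *)
Definition mover (t : nat) : player := if odd t then Player2 else Player1.

(* A strategy sees the whole history, from the initial position to the
   current one. *)
Definition strategy := seq position -> position.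

Definition history (u : nat -> position) (t : nat) : seq position :=
  mkseq u t.+1.

(* The first m turns u 0, ..., u m of a game on n copies of S_1 in which
   player P uses the strategy sigma. *)
Definition play (c k n : nat) (P : player) (sigma : strategy)
    (u : nat -> position) (m : nat) : Prop :=
  [/\ u 0 = msetn n (nacci c k 1),
      forall t, t < m -> move c k (u t) (u t.+1)
    & forall t, t < m -> mover t = P -> u t.+1 = sigma (history u t)].

(* Making the final move requires the game to stop, hence the clause excluding
   infinite plays. *)
Definition winning_strategy (c k n : nat) (P : player) (sigma : strategy)
    : Prop :=
  [/\ forall u m, play c k n P sigma u m -> mover m = P ->
        ~ terminal c k (u m) -> move c k (u m) (sigma (history u m)),
      forall u, ~ (forall m, play c k n P sigma u m)
    & forall u m, play c k n P sigma u m -> terminal c k (u m) ->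
        exists2 t, m = t.+1 & mover t = P].

Definition has_winning_strategy (c k n : nat) (P : player) : Prop :=
  exists sigma : strategy, winning_strategy c k n P sigma.

(* Main.v *)
Require Import Defs.
From mathcomp Require Import all_boot.
From mathcomp Require Import finmap multiset boolp zify.

(** The game is finite, so either the first player to move at the start or the
    other one can force a win; which of the two is settled by strategy stealing
    on the opening of the game.

    Finiteness.  Every move preserves the sum of the terms and creates a term
    larger than all those it removes.  Listed from the largest term down, the
    positions therefore increase lexicographically, and there are finitely many
    multisets of positive integers with a given sum.  Sums of [x * N.+1 ^ x]
    turn this into a bounded increasing natural number ([wf_move]).

    The opening.  As the sum is fixed, the number of ones can be forgotten, and
    an opening position is given by its numbers [j], [m], [l] of copies of
    [S 2], [S 3], [S 4].  In these coordinates the first moves read the same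
    way for all [k]:
    - (j, m, l) -> (j+1, m, l), the only possible move when [j < c] and the
      other coordinates are small;
    - (j+c, m, l) -> (j, m+1, l), which consumes [c] copies of [S 2];
    - (j+c, m+c, l) -> (j, m, l+1), which consumes [c] copies of [S 2] and
      of [S 3];
    - (j, m+c+1, l) -> (j, m, l+1), which consumes [c.+1] copies of [S 3].
    Write w for the predicate telling whether the player about to move wins.

    Stealing.  For [m < c] one has w(0, m+1, 0) = ~~ w(c, m, 0)
    ([wins_next_row]).  From (c, m, 0) one may only go to (0, m+1, 0) or to
    (c+1, m, 0).  If the first of these is won by the player to move, its unique
    successor (1, m+1, 0) is lost, and so the second one is won as well, because
    it has (1, m+1, 0) as an option.
    As w(c, m, 0) = w(0, m, 0) (+) odd c by the forced moves, it follows that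
    w(0, c, 0) = w(0, 0, 0) and w(c, c, 0) = w(0, 0, 0) (+) odd c.

    The contradiction.  Suppose w(0, 0, 0) = odd c, so that (c, c, 0) is lost by
    the player to move.  Its options (0, c+1, 0) and (0, 0, 1) are then won.
    The latter has the single successor (1, 0, 1), which is lost, hence
    (1, c+1, 0), which has (1, 0, 1) as an option, is won.  But (1, c+1, 0) and
    (0, 0, 1) are the only options of (0, c+1, 0), which is then lost, and this
    is absurd.  Hence w(0, 0, 0) = ~~ odd c, which is the theorem.  The position
    (1, c+1, 0) is where the bound on [n] comes from: reaching it takes up to
    (c+1)^3 + (c+1) ones. *)

Set Implicit Arguments.
Unset Strict Implicit.
Unset Printing Implicit Defensive.

Local Open Scope mset_scope.
Local Open Scope nat_scope.

(** * Determinacy and optimal strategies *)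

Section Determinacy.
Variables (T : Type) (R : T -> T -> Prop).

Inductive winning (p : T) : Prop :=
  Winning q of R p q & losing q
with losing (p : T) : Prop :=
  Losing of forall q, R p q -> winning q.

(** Both outcomes are inductive, so both carry a finite winning tree; on a
    well-founded part of the game no position escapes them. *)
Lemma losing_not_winning (p : T) : Acc (fun q p => R p q) p ->
  losing p <-> ~ winning p.
Proof.
elim=> {}p _ IHp; split=> [[winR] [q Rpq losq]|nwin_p].
  exact: (IHp q Rpq).1 losq (winR q Rpq).
constructor=> q Rpq; apply: contrapT => /(IHp q Rpq).2 losq.
exact: nwin_p (Winning Rpq losq).
Qed.

Lemma no_infinite_path (p : T) : Acc (fun q p => R p q) p ->
  forall u t, u t = p -> ~ (forall i, R (u i) (u i.+1)).
Proof.
elim=> {}p _ IHp u t utp Ru.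
by apply: (IHp (u t.+1) _ u t.+1 (erefl _) Ru); rewrite -utp.
Qed.

End Determinacy.

Section Strategies.
Variables c k n : nat.
Local Notation start := (msetn n (nacci c k 1)).

(** A memoryless strategy; the value in positions without a move to a lost
    position is arbitrary. *)
Definition move_to_losing (h : seq position) : position :=
  let p := last mset0 h in
  if pselect (exists q, move c k p q /\ losing (move c k) q) is left ex
  then projT1 (cid ex) else p.

Lemma last_history u t : last mset0 (history u t) = u t.
Proof.
by rewrite (last_nth mset0) size_mkseq -[RHS](nth_mkseq mset0 u (n := t.+1)).
Qed.

Lemma move_to_losingP u t : winning (move c k) (u t) ->
  move c k (u t) (move_to_losing (history u t)) /\
  losing (move c k) (move_to_losing (history u t)).
Proof.
case=> q mv_q los_q; rewrite /move_to_losing last_history.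
case: pselect => [ex|[]]; last by exists q.
exact: (projT2 (cid ex)).
Qed.

Lemma mover_succ t P : (mover t.+1 = P) <-> (mover t <> P).
Proof. by rewrite /mover /=; case: (odd t); case: P; split. Qed.

(** Along a play that follows [move_to_losing], [P] always moves from a winning
    position to a losing one.  The start must have a move:
    otherwise it is a losing position, but nobody makes a final move. *)
Lemma has_winning_strategy_of_start P :
    well_founded (fun q p => move c k p q) ->
    (if P is Player1 then winning (move c k) start
     else losing (move c k) start) ->
    ~ terminal c k start ->
  has_winning_strategy c k n P.
Proof.
move=> wf_move startP start_nterm.
have inv u m : play c k n P move_to_losing u m ->
    (mover m = P -> winning (move c k) (u m)) /\
    (mover m <> P -> losing (move c k) (u m)).
  elim: m => [|m IHm] [u0 mv_u sigma_u].
    by rewrite u0 /mover /=; case: P startP {sigma_u} => startP; split.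
  have [|win_m los_m] := IHm.
    by split=> // t lttm; [apply: mv_u | apply: sigma_u]; apply: ltnW.
  have mv_m := mv_u m (ltnSn m).
  split; first by move/mover_succ/los_m => -[]; apply.
  move/mover_succ => moverP.
  have {}moverP: mover m = P by apply: contrapT => nP; apply: moverP.
  rewrite sigma_u //; exact: (move_to_losingP (win_m moverP)).2.
exists move_to_losing; split=> [u m /inv[win_m _] /win_m/move_to_losingP[]//|u|].
  move=> play_u; apply: (no_infinite_path (wf_move (u 0)) (erefl (u 0))) => t.
  by have [_ mv_u _] := play_u t.+1; apply: mv_u.
move=> u m play_u term_m; have [win_m los_m] := inv _ _ play_u.
case: m => [|m] in play_u term_m win_m los_m *.
  by case: play_u => u0 _ _; rewrite u0 in term_m.
exists m => //; apply: contrapT => /mover_succ/win_m[q mv_q _].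
exact: term_m mv_q.
Qed.

End Strategies.

(** * Sums over multisets *)

Section Sums.
Variable f : nat -> nat.
Implicit Types A B : {mset nat}.

Definition msum A := \sum_(x <- A) f x.

Lemma msumD A B : msum (A `+` B) = msum A + msum B.
Proof.
rewrite /msum -big_cat; apply: perm_big.
by apply/allP=> x _ /=; rewrite count_cat !count_mem_mset msetE2.
Qed.

Lemma msum_msetn a x : msum (msetn a x) = a * f x.
Proof. by rewrite /msum enum_msetn big_nseq iter_addn_0 mulnC. Qed.

Lemma msum0 : msum mset0 = 0.
Proof. by rewrite /msum enum_mset0 big_nil. Qed.

Lemma msum_big I (r : seq I) (F : I -> {mset nat}) :
  msum (\big[msetD/mset0]_(i <- r) F i) = \sum_(i <- r) msum (F i).
Proof. exact: (big_morph msum msumD msum0). Qed.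

Lemma msum_ge_term (A : {mset nat}) x : x \in A -> f x <= msum A.
Proof. by move=> xA; rewrite /msum (big_rem x) //= leq_addr. Qed.

End Sums.

Local Notation weight := (msum id).

Lemma count_big (l h : nat) (F : nat -> {mset nat}) x :
  (\big[msetD/mset0]_(l <= j < h) F j) x = \sum_(l <= j < h) F j x.
Proof.
apply: (big_morph (fun A : {mset nat} => A x)) => [A B|].
  by rewrite msetE2.
exact: mset0E.
Qed.

(** * The (c,k)-nacci numbers *)

Section Nacci.
Variables c k : nat.
Hypotheses (c_gt0 : 0 < c) (k_gt0 : 0 < k).
Local Notation S := (nacci c k).

Lemma nacci_carry_init i : 1 <= i <= k -> S i.+1 = c.+1 * S i.
Proof.
case: i => [|[|i]] // ik; first by rewrite nacciS_small // big_nat1 nacci1; lia.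
rewrite nacciS_small // big_nat_recr //= mulSn.
by rewrite (@nacciS_small c k i.+1) //; lia.
Qed.

Lemma nacci_split_first : S k.+2 + 1 = c.+1 * S k.+1.
Proof.
rewrite nacciS_large // subSnn big_nat_recr //=.
by rewrite (@nacciS_small c k k) ?k_gt0 ?leqnn //; lia.
Qed.

Lemma nacci_split i : k.+1 < i -> S i.+1 + c * S (i - k - 1) = c.+1 * S i.
Proof.
case: i => // i; rewrite ltnS => lt_ki.
have := nacciS_large c (leqW lt_ki); rewrite big_nat_recr ?leq_subr //=.
have := nacciS_large c lt_ki; rewrite big_ltn; last by lia.
have -> : i.+1 - k - 1 = i - k by lia.
have -> : (i - k).+1 = i.+1 - k by lia.
move=> e1 e2; rewrite e2 mulSn e1; lia.
Qed.

Lemma nacci_leS i : S i <= S i.+1.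
Proof.
case: i => // i; case: (leqP i.+1 k) => ik.
  by rewrite [S i.+2]nacci_carry_init ?leq_pmull.
by rewrite (nacciS_large _ ik) big_nat_recr ?leq_subr //=; nia.
Qed.

Lemma nacci_gt0 i : 0 < i -> 0 < S i.
Proof.
case: i => // i _; elim: i => [|i IHi]; first by rewrite nacci1.
exact: leq_trans IHi (nacci_leS _).
Qed.

Lemma nacci_ltS i : 0 < i -> S i < S i.+1.
Proof.
move=> i_gt0; have Si_gt0 := nacci_gt0 i_gt0.
case: (leqP i k) => ik; first by rewrite nacci_carry_init ?i_gt0 //; nia.
case: i => // i in i_gt0 Si_gt0 ik *.
rewrite (nacciS_large _ ik) big_nat_recr ?leq_subr //=.
rewrite big_nat_recr /=; last by lia.
have := @nacci_gt0 i; nia.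
Qed.

Lemma nacci_lt i j : 0 < i -> i < j -> S i < S j.
Proof.
move=> i_gt0; elim: j => // j IHj; rewrite ltnS leq_eqVlt => /predU1P[<-|ij].
  exact: nacci_ltS.
by apply: ltn_trans (IHj ij) (nacci_ltS _); apply: leq_trans ij.
Qed.

Lemma nacci_eq i j : 0 < i -> 0 < j -> (S i == S j) = (i == j).
Proof.
move=> i_gt0 j_gt0; apply/eqP/eqP=> [eqS|-> //].
by case: (ltngtP i j) => [/(nacci_lt i_gt0)|/(nacci_lt j_gt0)|//]; rewrite eqS ltnn.
Qed.

(** Read as an inequality, each of the three carry identities gives this bound;
    iterated, it compares [S i.+1] with [c.+1 ^ i] for every [k]. *)
Lemma nacci_leMS i : 0 < i -> S i.+1 <= c.+1 * S i.
Proof.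
move=> i_gt0; case: (ltngtP i k.+1) => [ik|ik|->].
- by rewrite nacci_carry_init // i_gt0.
- by rewrite -nacci_split // leq_addr.
- by rewrite -nacci_split_first leq_addr.
Qed.

Lemma nacci2 : S 2 = c.+1.
Proof. by rewrite nacci_carry_init // nacci1 muln1. Qed.

(** * Termination *)

Lemma rule_weight A B : rule c k A B -> weight A = weight B.
Proof.
case=> [i ki|i /andP[i_gt0 ik]||i /andP[i_gt1 ik]||i ki];
  rewrite ?msumD ?msum_msetn ?mul1n ?msum_big //=.
- rewrite nacciS_large //; apply: eq_bigr => j _; exact: msum_msetn.
- rewrite (@nacciS_small c k i) ?i_gt0 // [in RHS]big_ltn // nacci1.
  rewrite (eq_bigr (fun j => c * S j)) => [|j _]; last exact: msum_msetn.
  lia.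
- by rewrite nacci2 nacci1 muln1.
- by rewrite nacci_carry_init //; lia.
- by rewrite -nacci_split_first nacci1.
- by rewrite -nacci_split // !mul1n.
Qed.

Lemma move_weight p q : move c k p q -> weight p = weight q.
Proof. by case=> A B C /rule_weight; rewrite !msumD => ->. Qed.

Lemma rule_new_max A B : rule c k A B ->
  exists2 i, S i.+1 \in B & forall x, x \in A -> x < S i.+1.
Proof.
have big_lt l i : 0 < l -> 
    forall x, x \in \big[msetD/mset0]_(l <= j < i.+1) msetn c (S j) -> x < S i.+1.
  move=> l_gt0; rewrite big_nat_cond.
  apply: (big_ind (fun A : {mset nat} => forall x, x \in A -> x < S i.+1)).
  - by move=> x; rewrite in_mset0.
  - by move=> A1 A2 IH1 IH2 x; rewrite in_msetD => /orP[/IH1|/IH2].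
  - move=> j; rewrite andbT => /andP[lj ji] x.
    rewrite in_msetn => /andP[_ /eqP->]; apply: nacci_lt => //.
    exact: leq_trans lj.
case=> [i ki|i /andP[i_gt0 ik]||i /andP[i_gt1 ik]||i ki].
- exists i; first by rewrite in_mset1.
  by apply: big_lt => //; lia.
- exists i; first by rewrite in_mset1.
  move=> x; rewrite in_msetD in_msetn => /orP[/andP[_ /eqP->]|]; last exact: big_lt.
  exact: nacci_lt.
- exists 1; first by rewrite in_mset1.
  by move=> x; rewrite in_msetn => /andP[_ /eqP->]; apply: nacci_ltS.
- exists i; first by rewrite in_mset1.
  by move=> x; rewrite in_msetn => /andP[_ /eqP->]; apply: nacci_ltS; apply: ltnW.
- exists k.+1; first by rewrite in_msetD in_mset1 eqxx.
  by move=> x; rewrite in_msetn => /andP[_ /eqP->]; apply: nacci_ltS.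
- exists i; first by rewrite in_msetD in_mset1 eqxx.
  by move=> x; rewrite in_msetn => /andP[_ /eqP->]; apply: nacci_ltS; lia.
Qed.

(** Each positive term contributes more than any multiset of smaller terms of
    weight at most [N], so this increases with the lexicographic order from the
    largest term down.  The factor [x] bounds the sum by the weight alone,
    whatever the number of terms. *)
Definition potential N := msum (fun x => x * N.+1 ^ x).

Lemma potential_le N A : potential N A <= weight A * N.+1 ^ weight A.
Proof.
rewrite [weight A in leqRHS]/msum big_distrl /= /potential /msum.
rewrite !big_seq; apply: leq_sum => x xA.
by rewrite leq_mul2l leq_pexp2l ?orbT // -big_seq; apply: (msum_ge_term id xA).
Qed.

Lemma rule_potential N A B : rule c k A B -> weight A <= N ->
  potential N A < potential N B.
Proof.
move=> rAB leAN; have [i sB lt_s] := rule_new_max rAB.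
have s_gt0 : 0 < S i.+1 by apply: nacci_gt0.
apply: (@leq_trans (S i.+1 * N.+1 ^ S i.+1)); last first.
  exact: (msum_ge_term (fun x => x * N.+1 ^ x) sB).
apply: (@leq_ltn_trans (weight A * N.+1 ^ (S i.+1).-1)).
  rewrite [weight A]/msum big_distrl /= /potential /msum.
  rewrite !big_seq; apply: leq_sum => x xA.
  by rewrite leq_mul2l leq_pexp2l ?orbT // -ltnS prednK // lt_s.
apply: (@leq_trans (N.+1 ^ S i.+1)); last exact: leq_pmull.
by rewrite -[in ltnRHS](prednK s_gt0) expnS ltn_pmul2r ?expn_gt0 // ltnS.
Qed.

Lemma move_potential N p q : move c k p q -> weight p <= N ->
  potential N p < potential N q.
Proof.
case=> A B C rAB; rewrite msumD => leN.
rewrite /potential !msumD ltn_add2r; apply: rule_potential => //.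
exact: leq_trans (leq_addr _ _) leN.
Qed.

Lemma wf_move : well_founded (fun q p => move c k p q).
Proof.
move=> p; have [N] := ubnP (weight p * (weight p).+1 ^ weight p
                            - potential (weight p) p).
elim: N p => [|N IHN] p ltN; first by rewrite ltn0 in ltN.
constructor=> q mv_pq; apply: IHN; rewrite -ltnS; apply: leq_trans ltN; rewrite ltnS.
have eq_w := move_weight mv_pq.
have lt_pq := move_potential mv_pq (leqnn _).
have := potential_le (weight p) q; rewrite -eq_w => le_q.
by apply: ltn_sub2l => //; apply: leq_trans lt_pq le_q.
Qed.

End Nacci.

(** * Positions up to the number of ones *)

Definition eq_off1 (A B : {mset nat}) := forall x, x != 1 -> A x = B x.

(** Moves preserve the weight, so this is what allows ones to be ignored when
    positions are compared. *)
Lemma eq_off1_weight A B : eq_off1 A B -> weight A = weight B -> A = B.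
Proof.
move=> eqAB eq_w.
have eqD : A `+` msetn (B 1) 1 = B `+` msetn (A 1) 1.
  apply/msetP=> x; rewrite !msetE2 !msetnE.
  by case: eqP => [->|/eqP/eqAB->//]; rewrite addnC.
have := congr1 weight eqD; rewrite !msumD !msum_msetn /= !muln1 eq_w.
move/addnI=> eq1; apply/msetP=> x.
by have [->|/eqAB//] := eqVneq x 1.
Qed.

Section States.
Variables c k n : nat.
Hypotheses (c_gt0 : 0 < c) (k_gt0 : 0 < k).
Local Notation S := (nacci c k).

(** The truncated subtraction is exact only when [weight T <= n]. *)
Definition fill_ones (T : {mset nat}) : {mset nat} := msetn (n - weight T) 1 `+` T.

Lemma fill_ones_off1 T : eq_off1 (fill_ones T) T.
Proof. by move=> x x1; rewrite msetE2 msetnE (negPf x1). Qed.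

Lemma fill_ones_weight T : weight T <= n -> weight (fill_ones T) = n.
Proof. by move=> leT; rewrite msumD msum_msetn muln1 subnK. Qed.

Lemma eq_fill_ones T p : eq_off1 p T -> weight T <= n -> weight p = n ->
  p = fill_ones T.
Proof.
move=> eq_p leT wp; apply: eq_off1_weight; last by rewrite fill_ones_weight.
by move=> x x1; rewrite eq_p // fill_ones_off1.
Qed.

(** The condition that [a] or [b] vanishes, true of every rule, ensures that the
    [a] ones to be removed are present as soon as the target has weight at most
    [n]. *)
Lemma fill_ones_move X Y R a b :
    rule c k (msetn a 1 `+` X) (msetn b 1 `+` Y) -> (a == 0) || (b == 0) ->
    weight (X `+` R) <= n -> weight (Y `+` R) <= n ->
  move c k (fill_ones (X `+` R)) (fill_ones (Y `+` R)).
Proof.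
move=> rXY ab0 leX leY.
have := rule_weight c_gt0 k_gt0 rXY.
rewrite !msumD !msum_msetn /= !muln1 => eq_w.
have le_a : a <= n - weight (X `+` R).
  by move: leX leY; rewrite !msumD; lia.
have := Move (msetn (n - weight (X `+` R) - a) 1 `+` R) rXY.
set p := _ `+` _; set q := _ `+` _ => mv_pq.
have p_off1 : eq_off1 p (X `+` R).
  by move=> x x1; rewrite !msetE2 !msetnE (negPf x1).
have q_off1 : eq_off1 q (Y `+` R).
  by move=> x x1; rewrite !msetE2 !msetnE (negPf x1).
have wp : weight p = n.
  by move: leX le_a; rewrite !msumD !msum_msetn /=; lia.
rewrite -(eq_fill_ones p_off1) // -(eq_fill_ones q_off1) //.
by rewrite -(move_weight c_gt0 k_gt0 mv_pq).
Qed.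

Lemma fill_ones_move_inv X Y R A B C :
    rule c k A B -> eq_off1 A X -> eq_off1 B Y ->
    A `+` C = fill_ones (X `+` R) ->
    weight (X `+` R) <= n -> weight (Y `+` R) <= n ->
  B `+` C = fill_ones (Y `+` R).
Proof.
move=> rAB eqAX eqBY eq_p leX leY; apply: eq_fill_ones => //.
  move=> x x1; rewrite !msetE2 (eqBY x x1); congr (_ + _).
  have := fill_ones_off1 (X `+` R) x1; rewrite -eq_p !msetE2 (eqAX x x1).
  exact: addnI.
by rewrite msumD -(rule_weight c_gt0 k_gt0 rAB) -msumD eq_p fill_ones_weight.
Qed.

Lemma count_combine l i j : 0 < l -> l <= j <= i ->
  c <= (\big[msetD/mset0]_(l <= h < i.+1) msetn c (S h)) (S j).
Proof.
move=> l_gt0 /andP[lj ji]; rewrite count_big (big_cat_nat (n := j)) ?(leqW ji) //=.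
by rewrite [X in _ + X]big_ltn // msetnxx addnCA leq_addr.
Qed.

(** The rules that can act on few copies of [S 2], [S 3] and [S 4], read up to
    ones; for the others, only the multiplicities that rule them out are kept.
    Reading rules up to ones identifies, for each index, the variants that
    depend on its position with respect to [k]. *)
Variant low_rule A B : Prop :=
| LowCarry1 of eq_off1 A mset0 & eq_off1 B [mset S 2]
| LowCombine2 of eq_off1 A (msetn c (S 2)) & eq_off1 B [mset S 3]
| LowCarry3 of eq_off1 A (msetn c.+1 (S 3)) & eq_off1 B [mset S 4]
| HighCarry i of (i == 2) || (3 < i) & c < A (S i)
| HighCombine i of 3 <= i & c <= A (S i) & c <= A (S i.-1).

Lemma low_ruleP A B : rule c k A B -> low_rule A B.
Proof.
have S1 : S 1 = 1 := nacci1 c k.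
case=> [i ki|i /andP[i_gt0 ik]||i /andP[i_gt1 ik]||i ki].
- have [i3|] := leqP 3 i.
    by apply: (@HighCombine _ _ i i3); apply: count_combine; lia.
  move=> i3; have -> : i = 2 by lia.
  have -> : 2 - k = 1 by lia.
  rewrite big_ltn // big_nat1 S1.
  by apply: LowCombine2 => x x1 //; rewrite !msetE2 !msetnE (negPf x1).
- have [i3|] := leqP 3 i.
    apply: (@HighCombine _ _ i i3); rewrite msetE2.
      by apply: leq_trans (leq_addl _ _); apply: count_combine; lia.
    by apply: leq_trans (leq_addl _ _); apply: count_combine; lia.
  case: i i_gt0 ik => [|[|[|//]]] // _ ik _; rewrite S1.
    rewrite big_geq // msetD0.
    by apply: LowCarry1 => x x1 //; rewrite msetnE mset0E (negPf x1).
  rewrite big_nat1.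
  by apply: LowCombine2 => x x1 //; rewrite !msetE2 !msetnE (negPf x1).
- by rewrite S1; apply: LowCarry1 => x x1 //; rewrite msetnE mset0E (negPf x1).
- have [->|i3] := eqVneq i 3; first by apply: LowCarry3 => x x1.
  by apply: (@HighCarry _ _ i); rewrite ?msetnxx //; lia.
- have [->|i3] := eqVneq k.+1 3.
    by apply: LowCarry3 => x x1 //; rewrite S1 !msetE2 !msetnE (negPf x1) addn0.
  by apply: (@HighCarry _ _ k.+1); rewrite ?msetnxx //; lia.
- have [i_eq|i3] := eqVneq i 3.
    rewrite i_eq; have -> : 3 - k - 1 = 1 by lia.
    by apply: LowCarry3 => x x1 //; rewrite S1 !msetE2 !msetnE (negPf x1) addn0.
  by apply: (@HighCarry _ _ i); rewrite ?msetnxx //; lia.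
Qed.

End States.

(** * The moves of the opening *)

(** A condition free of [k] under which the terms other than ones fit in [n]:
    the (c,k)-nacci numbers of index 2, 3 and 4 are replaced by their upper
    bounds [c.+1], [c.+1 ^ 2] and [c.+1 ^ 3], and a factor [c.+1] is removed.
    The slack of 1 admits the positions (1, c+1, 0) and (1, 0, 1). *)
Definition early c j m l := j + c.+1 * m + c.+1 ^ 2 * l <= c.+1 ^ 2 + 1.

Lemma early_row c j m : j <= c.+1 -> m <= c -> early c j m 0.
Proof. by rewrite /early => lejc lemc; rewrite -mulnn; nia. Qed.

Section Opening.
Variables c k n : nat.
Hypotheses (c_gt0 : 0 < c) (k_gt0 : 0 < k) (n_large : c.+1 ^ 3 + c.+1 <= n).
Local Notation S := (nacci c k).

Local Notation early := (early c).

Definition tail j m l : {mset nat} :=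
  msetn j (S 2) `+` (msetn m (S 3) `+` msetn l (S 4)).

Lemma early_weight j m l : early j m l -> weight (tail j m l) <= n.
Proof.
move=> fits; apply: leq_trans n_large.
have S2 : S 2 = c.+1 := nacci2 c_gt0 k_gt0.
have le3 : S 3 <= c.+1 ^ 2 by rewrite -mulnn -S2 S2 -[X in _ * X]S2 nacci_leMS.
have le4 : S 4 <= c.+1 ^ 3.
  rewrite expnS; apply: leq_trans (nacci_leMS c_gt0 k_gt0 _) _ => //.
  by rewrite leq_mul2l le3 orbT.
rewrite !msumD !msum_msetn /= S2.
move: fits le3 le4; rewrite /early; move: c.+1 => b fits le3 le4.
apply: (@leq_trans (b * (j + b * m + b ^ 2 * l))).
  rewrite !mulnDr -addnA (mulnA b b m) (mulnA b (b ^ 2) l) -expnS mulnn.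
  rewrite [b * j]mulnC leq_add2l.
  by rewrite leq_add // mulnC leq_mul2r ?le3 ?le4 orbT.
apply: (@leq_trans (b * (b ^ 2 + 1))); first by rewrite leq_mul2l fits orbT.
by rewrite mulnDr muln1 -expnS.
Qed.

Definition opening j m l := fill_ones n (tail j m l).

Lemma opening_count j m l i : 1 < i ->
  opening j m l (S i) = (i == 2) * j + ((i == 3) * m + (i == 4) * l).
Proof.
move=> i_gt1; have S1 : S 1 = 1 := nacci1 c k.
rewrite fill_ones_off1; last by rewrite -S1 nacci_eq //; lia.
rewrite !msetE2 !msetnE !nacci_eq //; try lia.
by do !case: eqP => _; rewrite ?mul1n ?mul0n.
Qed.

Lemma tail_add2 a j m l : tail (a + j) m l = msetn a (S 2) `+` tail j m l.
Proof. by apply/msetP=> x; rewrite !msetE2 !msetnE; do !case: eqP => _; lia. Qed.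

Lemma tail_add3 a j m l : tail j (a + m) l = msetn a (S 3) `+` tail j m l.
Proof. by apply/msetP=> x; rewrite !msetE2 !msetnE; do !case: eqP => _; lia. Qed.

Lemma tail_add4 a j m l : tail j m (a + l) = msetn a (S 4) `+` tail j m l.
Proof. by apply/msetP=> x; rewrite !msetE2 !msetnE; do !case: eqP => _; lia. Qed.

Local Notation mv := (move c k).

Lemma move_ones j m l : early j.+1 m l -> mv (opening j m l) (opening j.+1 m l).
Proof.
move=> fits; have r := CarryFirst c k.
rewrite /opening -add1n tail_add2 -{1}[tail j m l]mset0D.
apply: (@fill_ones_move _ _ _ c_gt0 k_gt0 _ _ _ c.+1 0) => //.
- by rewrite msetD0 msetn0 mset0D; rewrite nacci1 in r.
- by rewrite mset0D; apply: early_weight; rewrite /early in fits *; lia.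
- by rewrite -tail_add2; apply: early_weight.
Qed.

Lemma move_combine2 j m l : early (c + j) m l -> early j m.+1 l ->
  mv (opening (c + j) m l) (opening j m.+1 l).
Proof.
move=> fits fits'; rewrite /opening -[m.+1]add1n tail_add2 tail_add3.
have mvX a : rule c k (msetn a 1 `+` msetn c (S 2)) (msetn 0 1 `+` [mset S 3]) ->
    mv (fill_ones n (msetn c (S 2) `+` tail j m l))
       (fill_ones n ([mset S 3] `+` tail j m l)).
  move=> r; apply: (fill_ones_move c_gt0 k_gt0 r); rewrite ?orbT //.
    by rewrite -tail_add2; apply: early_weight.
  by rewrite -tail_add3; apply: early_weight.
have [k1|k_gt1] := leqP k 1.
  have {}k1 : k = 1 by lia.
  apply: (mvX c); have := @Combine c k 2; rewrite k1 => /(_ isT).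
  by rewrite big_ltn // big_nat1 nacci1 msetn0 mset0D.
apply: (mvX c.+1).
have := @CombineInit c k 2; rewrite k_gt1 => /(_ isT).
by rewrite big_nat1 nacci1 msetn0 mset0D.
Qed.

Lemma move_combine3 j m l : early (c + j) (c + m) l -> early j m l.+1 ->
  mv (opening (c + j) (c + m) l) (opening j m l.+1).
Proof.
move=> fits fits'; rewrite /opening -[l.+1]add1n tail_add2 tail_add3 tail_add4 msetDA.
have mvX a : rule c k (msetn a 1 `+` (msetn c (S 2) `+` msetn c (S 3)))
                      (msetn 0 1 `+` [mset S 4]) ->
    mv (fill_ones n ((msetn c (S 2) `+` msetn c (S 3)) `+` tail j m l))
       (fill_ones n ([mset S 4] `+` tail j m l)).
  move=> r; apply: (fill_ones_move c_gt0 k_gt0 r); rewrite ?orbT //.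
    by rewrite -msetDA -tail_add3 -tail_add2; apply: early_weight.
  by rewrite -tail_add4; apply: early_weight.
have [k_gt2|k_le2] := ltnP 2 k.
  apply: (mvX c.+1); have := @CombineInit c k 3; rewrite k_gt2 => /(_ isT).
  by rewrite big_ltn // big_nat1 nacci1 msetn0 mset0D.
have [k2|k_neq2] := eqVneq k 2.
  apply: (mvX c); have := @Combine c k 3; rewrite k2 => /(_ isT).
  by rewrite big_ltn // big_ltn // big_nat1 nacci1 msetn0 mset0D.
have k1 : k = 1 by lia.
apply: (mvX 0); have := @Combine c k 3; rewrite k1 => /(_ isT).
by rewrite big_ltn // big_nat1 !msetn0 !mset0D.
Qed.

Lemma move_carry3 j m l : early j (c.+1 + m) l ->
  mv (opening j (c.+1 + m) l) (opening j m l.+1).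
Proof.
move=> fits; rewrite /opening -[l.+1]add1n tail_add3 tail_add4.
have mvX b : rule c k (msetn 0 1 `+` msetn c.+1 (S 3)) (msetn b 1 `+` [mset S 4]) ->
    mv (fill_ones n (msetn c.+1 (S 3) `+` tail j m l))
       (fill_ones n ([mset S 4] `+` tail j m l)).
  move=> r; apply: (fill_ones_move c_gt0 k_gt0 r); rewrite ?orbT //.
    by rewrite -tail_add3; apply: early_weight.
  by rewrite -tail_add4; apply: early_weight; rewrite /early in fits *; lia.
have [k_gt2|k_le2] := ltnP 2 k.
  by apply: (mvX 0); rewrite !msetn0 !mset0D; apply: CarryInit.
have [k2|k_neq2] := eqVneq k 2.
  apply: (mvX 1).
  by have := SplitFirst c k; rewrite k2 nacci1 msetn0 mset0D msetDC.
have k1 : k = 1 by lia.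
apply: (mvX c); have := @Defs.Split c k 3; rewrite k1 => /(_ isT).
by rewrite nacci1 msetn0 mset0D msetDC.
Qed.

(** The hypotheses exclude every removal of [S 3] and [S 4] except a carry from
    [c.+1] copies of [S 3], and every removal of [S 2] except a combination of
    exactly [c] of them. *)
Lemma opening_moves j m l q :
    early j.+1 m l -> j <= c -> l <= c ->
    (m < c) || [&& j < c, m <= c.+1 & l < c] ->
    mv (opening j m l) q ->
  [\/ q = opening j.+1 m l, j = c /\ q = opening 0 m.+1 l
    | m = c.+1 /\ q = opening j 0 l.+1].
Proof.
move=> fits le_jc le_lc small; move eq_p: (opening j m l) => p mv_pq.
case: mv_pq eq_p => A B C rAB eq_p.
have fits0 : early j m l by rewrite /early in fits *; lia.
have countA i : 1 < i -> A (S i) <= (i == 2) * j + ((i == 3) * m + (i == 4) * l).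
  by move=> i_gt1; rewrite -(opening_count j m l i_gt1) eq_p msetE2 leq_addr.
have S_neq1 i : 1 < i -> S i != 1.
  by move=> i_gt1; rewrite -(nacci1 c k) nacci_eq //; lia.
case: (low_ruleP c_gt0 k_gt0 rAB) => [A0 B2|A2 B3|A3 B4|i i_eq ltA|i i3 leA leA1].
- apply: Or31; rewrite /opening -add1n tail_add2.
  apply: (fill_ones_move_inv c_gt0 k_gt0 rAB A0 B2); rewrite ?mset0D -?tail_add2 //;
  exact: early_weight.
- have := countA 2 isT; rewrite A2 ?S_neq1 // msetnxx => le_cj.
  have {le_cj} j_eq : j = c by lia.
  rewrite {}j_eq in le_jc fits fits0 eq_p small *; apply: Or32; split=> //.
  rewrite /opening -add1n tail_add3.
  apply: (fill_ones_move_inv c_gt0 k_gt0 rAB A2 B3);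
    rewrite -?tail_add2 -?tail_add3 ?addn0 //; apply: early_weight => //.
  by rewrite /early in fits *; lia.
- have := countA 3 isT; rewrite A3 ?S_neq1 // msetnxx => le_cm.
  have {le_cm} m_eq : m = c.+1 by lia.
  rewrite {}m_eq in fits fits0 eq_p small *; apply: Or33; split=> //.
  rewrite /opening -add1n tail_add4.
  apply: (fill_ones_move_inv c_gt0 k_gt0 rAB A3 B4);
    rewrite -?tail_add3 -?tail_add4 ?addn0 //; apply: early_weight => //.
  by rewrite /early in fits0 *; lia.
- by have := countA i; lia.
- by have := countA i; have := countA i.-1; lia.
Qed.

End Opening.

(** * Strategy stealing *)

Section Stealing.
Variables c k n : nat.
Hypotheses (c_gt0 : 0 < c) (k_gt0 : 0 < k) (n_large : c.+1 ^ 3 + c.+1 <= n).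
Local Notation mv := (move c k).

Let losingE p : losing mv p <-> ~ winning mv p.
Proof. exact: losing_not_winning (wf_move c_gt0 k_gt0 p). Qed.

Definition wins p := `[< winning mv p >].

Lemma wins_move p q : mv p q -> ~~ wins q -> wins p.
Proof.
move=> mv_pq /asboolPn/losingE los_q.
by apply/asboolP; apply: Winning los_q.
Qed.

Lemma wins_inv p : wins p -> exists2 q, mv p q & ~~ wins q.
Proof.
by move=> /asboolP[q mv_pq /losingE nwin_q]; exists q => //; apply/asboolPn.
Qed.

Local Notation w j m l := (wins (opening c k n j m l)).

Lemma wins_forced j m l :
    early c j.+1 m l -> j < c ->
    (m <= c) && (l == 0) || (m == 0) && (l <= 1) ->
  w j m l = ~~ w j.+1 m l.
Proof.
move=> fits lt_jc small; apply/idP/idP=> [/wins_inv[q]|]; last first.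
  by apply: wins_move; apply: (move_ones c_gt0 k_gt0 n_large).
case/(opening_moves c_gt0 k_gt0 n_large fits (ltnW lt_jc)).
- by lia.
- by lia.
- by move=> ->.
- by case; lia.
- by case; lia.
Qed.

Lemma wins_row j m : j <= c -> m <= c -> w j m 0 = w 0 m 0 (+) odd j.
Proof.
move=> le_jc le_mc; elim: j le_jc => [|j IHj] lt_jc; first by rewrite addbF.
rewrite /= addbN -IHj ?(ltnW lt_jc) // (@wins_forced j) ?negbK ?le_mc //.
by apply: early_row; lia.
Qed.

(** The stealing step.  If (0, m+1, 0) is won, its forced successor (1, m+1, 0)
    is lost.  A player who, rather than enter the next row from (c, m, 0), waits
    at (c+1, m, 0) then puts this lost position within the reach of the opponent,
    so waiting does not help. *)
Lemma wins_next_row m : m < c -> w 0 m.+1 0 = ~~ w c m 0.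
Proof.
move=> lt_mc; apply/idP/idP=> [win1|]; last first.
  move=> /negP nwin; apply: contraT => nwin1; case: nwin.
  apply: wins_move nwin1.
  have := @move_combine2 c k n c_gt0 k_gt0 n_large 0 m 0.
  by rewrite addn0; apply; apply: early_row; lia.
apply/negP=> /wins_inv[q].
have nwin11 : ~~ w 1 m.+1 0.
  by rewrite -wins_forced //; [apply: early_row | rewrite lt_mc]; lia.
have win_c1 : w c.+1 m 0.
  apply: wins_move nwin11.
  have := @move_combine2 c k n c_gt0 k_gt0 n_large 1 m 0.
  by rewrite addn1; apply; apply: early_row; lia.
move/(opening_moves c_gt0 k_gt0 n_large)=> cases.
have [] := cases; rewrite ?lt_mc //; first by apply: early_row; lia.
- by move=> ->; rewrite win_c1.
- by move=> [_ ->]; rewrite win1.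
- by case; lia.
Qed.

Lemma wins_start : w 0 0 0 = ~~ odd c.
Proof.
have rows m : m <= c -> w 0 m 0 = w 0 0 0 (+) (~~ odd c && odd m).
  elim: m => [|m IHm] lt_mc; first by rewrite andbF addbF.
  rewrite wins_next_row // (wins_row (leqnn c) (ltnW lt_mc)) (IHm (ltnW lt_mc)) /=.
  by case: (w 0 0 0); case: (odd c); case: (odd m).
have [//|start_odd] := eqVneq (w 0 0 0) (~~ odd c).
have {}start_odd : w 0 0 0 = odd c.
  by case: (w 0 0 0) (odd c) start_odd => [] [].
have early_cc1 : early c 1 c.+1 0 by rewrite /early -mulnn; lia.
have early_001 : early c 0 0 1 by rewrite /early; lia.
have early_101 : early c 1 0 1 by rewrite /early; lia.
(* In row c, combining [S 2] and [S 3] becomes possible, and the stealing step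
   no longer applies. *)
have lose_cc : ~~ w c c 0.
  by rewrite wins_row // rows // start_odd andNb addbF addbb.
have win_0c1 : w 0 c.+1 0.
  apply: contraNT lose_cc; apply: wins_move.
  have := @move_combine2 c k n c_gt0 k_gt0 n_large 0 c 0; rewrite addn0.
  by apply; [apply: early_row | move: early_cc1; rewrite /early; lia].
have win_001 : w 0 0 1.
  apply: contraNT lose_cc; apply: wins_move.
  have := @move_combine3 c k n c_gt0 k_gt0 n_large 0 0 0; rewrite addn0.
  by apply => //; apply: early_row.
have lose_101 : ~~ w 1 0 1 by rewrite -wins_forced.
have win_1c1 : w 1 c.+1 0.
  apply: wins_move lose_101.
  have := @move_carry3 c k n c_gt0 k_gt0 n_large 1 0 0; rewrite addn0.
  exact.
have [q] := wins_inv win_0c1.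
case/(opening_moves c_gt0 k_gt0 n_large early_cc1) => //; first by lia.
- by move=> ->; rewrite win_1c1.
- by case; lia.
- by move=> [_ ->]; rewrite win_001.
Qed.

Lemma opening_start : opening c k n 0 0 0 = msetn n (nacci c k 1).
Proof.
rewrite /opening /tail !msetn0 !mset0D.
by rewrite /fill_ones msetD0 msum0 subn0 nacci1.
Qed.

End Stealing.

Theorem theorem1p6 (c k n : nat) (hc : 1 <= c) (hk : 1 <= k)
    (hn : (c + 1) ^ 3 + (c + 1) <= n) :
  (odd c -> has_winning_strategy c k n Player2) /\
  (~~ odd c -> has_winning_strategy c k n Player1).
Proof.
rewrite addn1 in hn.
have := wins_start hc hk hn; rewrite /wins opening_start => start_win.
have wf := wf_move hc hk.
have start_move : ~ terminal c k (msetn n (nacci c k 1)).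
  move=> /(_ (opening c k n 1 0 0)); apply; rewrite -opening_start.
  exact: (move_ones hc hk hn (early_row (isT : 0 < c.+1) (leq0n c))).
split=> c_parity; apply: has_winning_strategy_of_start => //.
  by apply/(losing_not_winning (wf _))/asboolPn; rewrite start_win c_parity.
by apply/asboolP; rewrite start_win.
Qed.
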